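(* Let $X$ be a measurable space, let $\mathcal{H}_{1},\mathcal{H}_{2}$ be complex separable Hilbert spaces, and let $\pi_i:\mathcal{O}(X)\to\mathcal{B}(\mathcal{H}_{i})$, $i=1,2$, be two spectral measures. Then the following are equivalent: (1) $\pi_1$ and $\pi_2$ are mutually singular. (2) $\pi_1$ and $\pi_2$ are disjoint. (3) If $T\in\mathcal{B}(\mathcal{H}_{1},\mathcal{H}_{2})$ satisfies $T\pi_1(A)=\pi_2(A)T$ for all $A\in\mathcal{O}(X)$, then $T=0$.
   Context: A measurable space is a nonempty set $X$ with a $\sigma$-algebra $\mathcal{O}(X)$ of subsets; all singletons are assumed measurable. $\mathcal{B}(\mathcal{H},\mathcal{K})$ is the space of bounded linear operators $\mathcal{H}\to\mathcal{K}$, and $\mathcal{B}(\mathcal{H})=\mathcal{B}(\mathcal{H},\mathcal{H})$. A spectral measure on $X$ acting on $\mathcal{H}$ is a map $\pi:\mathcal{O}(X)\to\mathcal{B}(\mathcal{H})$ such that every $\pi(A)$ is a (self-adjoint) projection, $A\mapsto\langle h,\pi(A)k\rangle$ is a complex measure for all $h,k\in\mathcal{H}$, and $\pi(X)=I_{\mathcal{H}}$. $\pi_1$ and $\pi_2$ are mutually singular if there are disjoint measurable subsets $X_1,X_2$ of $X$ such that $\pi_i(A)=\pi_i(A\cap X_i)$ for all $A\in\mathcal{O}(X)$ and $i=1,2$. If $\mathcal{K}$ is a closed subspace of $\mathcal{H}$ invariant under $\pi(A)$ for all $A\in\mathcal{O}(X)$, the spectral measure $A\mapsto\pi(A)|_{\mathcal{K}}\in\mathcal{B}(\mathcal{K})$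 is called a sub-spectral measure of $\pi$; it is non-zero if $\mathcal{K}\neq\{0\}$. Two spectral measures $\pi_1,\pi_2$ are disjoint if no non-zero sub-spectral measure of $\pi_1$ is unitarily equivalent to any sub-spectral measure of $\pi_2$ (unitary equivalence of $\rho_1,\rho_2$ acting on $\mathcal{K}_1,\mathcal{K}_2$ means that there is a unitary $U:\mathcal{K}_1\to\mathcal{K}_2$ with $U\rho_1(A)=\rho_2(A)U$ for all $A$). *)

(* Defs.v *)
From HB Require Import structures.
From mathcomp Require Import all_boot all_order all_algebra.
From mathcomp.algebra Require Import sesquilinear.
From mathcomp Require Import complex.
From mathcomp Require Import all_classical all_reals all_analysis.

Set Implicit Arguments.
Unset Strict Implicit.
Unset Printing Implicit Defensive.

Import Order.TTheory GRing.Theory Num.Theory Num.Def.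
Import numFieldNormedType.Exports.

Local Open Scope classical_set_scope.
Local Open Scope ring_scope.
Local Open Scope complex_scope.

(* Following [sesquilinear], the inner product is linear in its first argument
   and conjugate-linear in its second one. *)
HB.mixin Record CompleteNormedModule_isHilbert (R : realType) H
    & CompleteNormedModule R[i] H := {
  inner : {dot H for conjC};
  inner_norm : forall x : H, inner x x = `|x| ^+ 2
}.

#[short(type="hilbertType")]
HB.structure Definition Hilbert (R : realType) :=
  {H of CompleteNormedModule R[i] H & CompleteNormedModule_isHilbert R H}.

Definition separable_space (T : topologicalType) :=
  exists2 D : set T, countable D & dense D.

Section BoundedOperators.
Variable R : realType.

Record boundedOp (H K : hilbertType R) := BoundedOp {
  op_fun :> H -> K;
  op_linear : linear op_fun;
  op_bounded : exists M : R, forall x, `|op_fun x| <= M%:C * `|x|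
}.

HB.instance Definition _ H K (T : boundedOp H K) :=
  GRing.isLinear.Build R[i] H K *:%R (op_fun T) (op_linear T).

Let zero_linear (H K : hilbertType R) : linear (fun _ : H => 0 : K).
Proof. by move=> a x y; rewrite scaler0 addr0. Qed.

Let zero_bounded (H K : hilbertType R) :
  exists M : R, forall x : H, `|0 : K| <= M%:C * `|x|.
Proof. by exists 0 => x; rewrite normr0 mul0r. Qed.

Definition zero_op (H K : hilbertType R) : boundedOp H K :=
  BoundedOp (@zero_linear H K) (@zero_bounded H K).

Definition is_projection (H : hilbertType R) (P : boundedOp H H) :=
  (forall x, P (P x) = P x) /\ (forall x y, inner (P x) y = inner x (P y)).

Definition is_unitary (H K : hilbertType R) (U : boundedOp H K) :=
  (forall x y, inner (U x) (U y) = inner x y) /\ (forall y, exists x, U x = y).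

End BoundedOperators.

Section ClosedSubspaces.
Variables (R : realType) (H : hilbertType R).

Record closedSubspace := ClosedSubspace {
  cs_pred :> {pred H};
  cs_submod : submod_closed cs_pred;
  cs_closed : closed [set x | x \in cs_pred]
}.

HB.instance Definition _ (K : closedSubspace) :=
  GRing.isSubmodClosed.Build R[i] H (cs_pred K) (cs_submod K).

Record subspace_of (K : closedSubspace) := SubspaceVec {
  cs_val : H;
  cs_valP : cs_val \in cs_pred K
}.

Variable K : closedSubspace.

HB.instance Definition _ := [isSub for @cs_val K].
HB.instance Definition _ := [Choice of subspace_of K by <:].
HB.instance Definition _ := [SubChoice_isSubLmodule of subspace_of K by <:].

Let norm (x : subspace_of K) : R[i] := `|cs_val x|.

Let ler_norm x y : norm (x + y) <= norm x + norm y.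
Proof. exact: ler_normD. Qed.
Let norm_scale (l : R[i]) x : norm (l *: x) = `|l| * norm x.
Proof. exact: normrZ. Qed.
Let norm_eq0 x : norm x = 0 -> x = 0.
Proof. by move=> /normr0_eq0 x0; apply: val_inj; rewrite /= x0. Qed.

HB.instance Definition _ := Lmodule_isNormed.Build R[i] (subspace_of K)
  ler_norm norm_scale norm_eq0.

Let sub_cauchy_cvg (F : set_system (subspace_of K)) :
  ProperFilter F -> cauchy F -> cvg F.
Proof.
move=> FF Fc.
have /cauchy_cvg Gc : cauchy (@cs_val K @ F).
  apply/cauchy_ballP => e e0.
  have /cauchy_ballP/(_ e e0)[/= [A B] [FA FB] AB] := Fc.
  exists (@cs_val K @` A, @cs_val K @` B) => /=.
    by split; [apply: filterS FA => x Ax|apply: filterS FB => x Bx]; exists x.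
  move=> [_ _] [/= [x Ax <-] [y By <-]].
  by have := AB (x, y) (conj Ax By); rewrite -!ball_normE.
have lK : lim (@cs_val K @ F) \in cs_pred K.
  apply: (@closed_cvg _ _ F FF (@cs_val K) _ (cs_closed (c := K)) _ _ Gc).
  by apply: nearW => x; exact: cs_valP.
apply/cvg_ex; exists (SubspaceVec lK).
apply/cvg_ballP => e e0.
have /cvg_ballP/(_ e e0) := Gc.
by apply: filterS => x; rewrite -!ball_normE.
Qed.

HB.instance Definition _ :=
  Uniform_isComplete.Build (subspace_of K) sub_cauchy_cvg.

Definition sub_inner (x y : subspace_of K) : R[i] :=
  inner (cs_val x) (cs_val y).

Let sub_inner_bilinear :
  bilinear_for (GRing.Scale.Law.clone _ _ ( *%R ) _)
    (GRing.Scale.Law.clone _ _ (conjC \; *%R) _) sub_inner.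
Proof.
split=> u a x y; rewrite /sub_inner /=.
  by rewrite linearPl.
by rewrite linearPr.
Qed.

HB.instance Definition _ :=
  bilinear_isBilinear.Build R[i] _ _ _ _ _ sub_inner sub_inner_bilinear.

Let sub_inner_herm x y : sub_inner x y = (-1) ^+ false * conjC (sub_inner y x).
Proof. exact: hermitian_subproof. Qed.

HB.instance Definition _ :=
  isHermitianSesquilinear.Build R[i] _ false conjC sub_inner sub_inner_herm.

Let sub_inner_gt0 u : u != 0 -> 0 < sub_inner u u.
Proof.
move=> u0; apply: neq0_dnorm_gt0; apply: contra u0 => /eqP u0.
by apply/eqP/val_inj; rewrite /= u0.
Qed.

HB.instance Definition _ := isDotProduct.Build R[i] _ sub_inner sub_inner_gt0.

Let sub_inner_norm (x : subspace_of K) : sub_inner x x = `|x| ^+ 2.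
Proof. exact: inner_norm. Qed.

HB.instance Definition _ :=
  CompleteNormedModule_isHilbert.Build R (subspace_of K) sub_inner_norm.

End ClosedSubspaces.

Section Restriction.
Variables (R : realType) (H : hilbertType R) (K : closedSubspace H).
Implicit Type T : boundedOp H H.

Definition stable T := forall x, x \in K -> T x \in K.

Definition restr_fun T (TK : stable T) (x : subspace_of K) : subspace_of K :=
  SubspaceVec (TK (cs_val x) (cs_valP x)).

Let restr_linear T (TK : stable T) : linear (restr_fun TK).
Proof. by move=> a x y; apply: val_inj; rewrite /= linearP. Qed.

Let restr_bounded T (TK : stable T) :
  exists M : R, forall x, `|restr_fun TK x| <= M%:C * `|x|.
Proof. by have [M TM] := op_bounded T; exists M => x; exact: TM. Qed.

Definition restr_op T (TK : stable T) :
    boundedOp (subspace_of K) (subspace_of K) :=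
  BoundedOp (restr_linear TK) (restr_bounded TK).

End Restriction.

Section SpectralMeasures.
Context (R : realType) d (X : measurableType d).

Definition complex_measure (mu : set X -> R[i]) :=
  forall F : (set X)^nat, (forall n, measurable (F n)) -> trivIset setT F ->
    (fun n => \sum_(0 <= i < n) mu (F i) : R[i]^o) @ \oo
      --> (mu (\bigcup_n F n) : R[i]^o).

(* Operators attached to non-measurable sets carry no meaning: every use of a
   spectral measure below is restricted to measurable sets. A [measurableType]
   is pointed, hence nonempty. *)
Record spectralMeasure (H : hilbertType R) := SpectralMeasure {
  sm_op :> set X -> boundedOp H H;
  sm_projection : forall A, measurable A -> is_projection (sm_op A);
  sm_measure : forall h k, complex_measure (fun A => inner h (sm_op A k));
  sm_total : forall x, sm_op [set: X] x = x
}.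

Definition mutually_singular (H1 H2 : hilbertType R)
    (pi1 : spectralMeasure H1) (pi2 : spectralMeasure H2) :=
  exists X1 X2 : set X, [/\ measurable X1, measurable X2, X1 `&` X2 = set0 &
    forall A, measurable A ->
      pi1 A =1 pi1 (A `&` X1) /\ pi2 A =1 pi2 (A `&` X2)].

Definition unitarily_equivalent (H1 H2 : hilbertType R)
    (rho1 : spectralMeasure H1) (rho2 : spectralMeasure H2) :=
  exists U : boundedOp H1 H2, is_unitary U /\
    forall A, measurable A -> forall x, U (rho1 A x) = rho2 A (U x).

Section SubSpectralMeasure.
Variables (H : hilbertType R) (pi : spectralMeasure H) (K : closedSubspace H).

Definition invariant_subspace :=
  forall A, measurable A -> stable K (pi A).

Context (Kpi : invariant_subspace).

Definition sub_op (A : set X) : boundedOp (subspace_of K) (subspace_of K) :=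
  if pselect (measurable A) is left mA then restr_op (Kpi mA)
  else zero_op (subspace_of K) (subspace_of K).

Lemma sub_opE A x : measurable A -> cs_val (sub_op A x) = pi A (cs_val x).
Proof. by rewrite /sub_op; case: pselect. Qed.

Let sub_projection A : measurable A -> is_projection (sub_op A).
Proof.
move=> mA; have [pid psa] := sm_projection pi mA; split=> [x|x y].
  by apply: val_inj; rewrite /= !sub_opE.
by rewrite /inner /= /sub_inner !sub_opE.
Qed.

Let sub_measure h k : complex_measure (fun A => inner h (sub_op A k)).
Proof.
move=> F mF tF.
have := @sm_measure _ pi (cs_val h) (cs_val k) F mF tF.
have E A : measurable A ->
    inner h (sub_op A k) = inner (cs_val h) (pi A (cs_val k)).
  by move=> mA; rewrite {1}/inner /= /sub_inner sub_opE.
rewrite E; last exact: bigcupT_measurable.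
by under [X in _ -> (X @ _ --> _)]eq_fun do under eq_bigr do rewrite E//.
Qed.

Let sub_total x : sub_op [set: X] x = x.
Proof. by apply: val_inj; rewrite /= sub_opE// sm_total. Qed.

Definition sub_spectral : spectralMeasure (subspace_of K) :=
  SpectralMeasure sub_projection sub_measure sub_total.

End SubSpectralMeasure.

Definition disjoint_spectral (H1 H2 : hilbertType R)
    (pi1 : spectralMeasure H1) (pi2 : spectralMeasure H2) :=
  forall (K1 : closedSubspace H1) (K2 : closedSubspace H2)
    (K1pi : invariant_subspace pi1 K1) (K2pi : invariant_subspace pi2 K2),
    (exists2 x, x \in K1 & x != 0) ->
    ~ unitarily_equivalent (sub_spectral K1pi) (sub_spectral K2pi).

End SpectralMeasures.

(* Main.v *)
From HB Require Import structures.
Require Import Defs.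
From mathcomp Require Import all_boot all_order all_algebra.
From mathcomp.algebra Require Import sesquilinear.
From mathcomp Require Import complex lra ring.
From mathcomp Require Import all_classical all_reals all_analysis.

Set Implicit Arguments.
Unset Strict Implicit.
Unset Printing Implicit Defensive.

Import Order.TTheory GRing.Theory Num.Theory.
Import numFieldNormedType.Exports.

Local Open Scope classical_set_scope.
Local Open Scope ring_scope.

(** The implications form a cycle: mutually singular, no intertwiner,
    disjoint, mutually singular.

    If X1 and X2 carry [pi1] and [pi2], an intertwiner T satisfies
    T = T pi1(X1) = pi2(X1) T = pi2(X1 cap X2) T = 0 ([singular_intertwiner]).
    A unitary equivalence of sub-spectral measures on K1 and K2, preceded by
    the orthogonal projection onto K1, is an intertwiner, and it vanishes only
    if K1 = 0 ([intertwiner_disjoint]).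

    The remaining implication works with the scalar measures
    A |-> |pi(A) h|^2, called weights, and with a cyclicity principle
    ([equal_weight_disjoint]): if h and k have the same weight for [pi1] and
    [pi2], then sum_i c_i pi1(A_i) h |-> sum_i c_i pi2(A_i) k is isometric, and
    its closure is a unitary equivalence between the cyclic sub-spectral
    measures of h and k.  Hence disjointness forces h = k = 0.

    Let now h and k be arbitrary.  Hahn decompositions of the differences of
    weight k and multiples of weight h split X into a set where
    h vanishes, a set where k vanishes, and countably many sets E on which the
    two weights are comparable, each at most a multiple of the other.  On such
    an E, h can be changed into a vector with exactly the weight of pi2(E) k
    ([ex_equal_weight]).  This amounts to applying to h the square root of the
    density of one weight with respect to the other, but neither densities nor
    integrals occur: if weight h' <= weight k <= C weight h', one Hahn set B
    tells where to multiply h' by the fourth root of C, and the constant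
    becomes sqrt C; iterating, the constants tend to 1 fast enough for the
    vectors to converge.  Disjointness then gives pi2(E) k = 0, so one
    measurable set separates h from k ([separate_pair]).  Applying this
    to the members of two dense sequences and taking countable unions and
    intersections yields one set that separates [pi1] from [pi2]
    ([separated_singular]); this is where separability enters. *)

(** * Dyadic error bounds *)

Section DyadicSequence.
Variable R : realType.
Implicit Types a b c : R.

Definition dyad n : R := 2^-1 ^+ n.

Lemma dyad_gt0 n : 0 < dyad n.
Proof. by rewrite exprn_gt0 ?invr_gt0. Qed.

Lemma dyadS n : dyad n.+1 = dyad n / 2.
Proof. by rewrite /dyad exprSr. Qed.

Lemma dyad_le1 n : dyad n <= 1.
Proof. by rewrite exprn_ile1 ?invr_ge0// invf_le1 ?ler1n. Qed.

Lemma le_dyad n m : (n <= m)%N -> dyad m <= dyad n.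
Proof. by move=> nm; rewrite ler_wiXn2l ?invr_ge0// invf_le1 ?ler1n. Qed.

Lemma cvg_dyad c : (fun n => c * dyad n) @ \oo --> 0.
Proof.
rewrite -[X in _ --> X](mulr0 c); apply: cvgM; first exact: cvg_cst.
by apply: cvg_expr; rewrite ger0_norm ?invr_ge0// invf_lt1 ?ltr1n.
Qed.

Lemma dyad_small c (e : R) : 0 < e -> exists n, c * dyad n < e.
Proof.
move=> e0; have /cvgrPdist_lt/(_ e e0)[N _ /(_ N (leqnn N))] := cvg_dyad c.
by rewrite /= sub0r normrN => /(le_lt_trans (ler_norm _)); exists N.
Qed.

Lemma ler_dyad a b c : (forall n, a <= b + c * dyad n) -> a <= b.
Proof.
move=> h; apply/ler_addgt0Pr => e e0; have [n cn] := dyad_small c e0.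
by apply: le_trans (h n) _; rewrite lerD2l ltW.
Qed.

End DyadicSequence.

(** * Hilbert spaces through their real inner product *)

Lemma Re_cvg (R : realType) (u : nat -> R[i]) (l : R[i]) :
  (u : nat -> R[i]^o) @ \oo --> (l : R[i]^o) ->
  (fun n => complex.Re (u n)) @ \oo --> complex.Re l.
Proof.
move=> /cvgrPdist_lt ul; apply/cvgrPdist_lt => e e0.
have e0' : 0 < (e%:C)%C by rewrite ltcR.
apply: filterS (ul _ e0') => n /= lt1; rewrite -ltcR; apply: le_lt_trans lt1.
by rewrite -raddfB; exact: normc_ge_Re.
Qed.

Section RealStructure.
Variables (R : realType) (H : hilbertType R).
Implicit Types (x y z : H) (a : R) (c : R[i]).
Local Open Scope complex_scope.

(** The norm of a space over R[i] is a nonnegative complex number; this is the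
    same number as an element of R, where order and arithmetic are usable. *)
Definition nrm x : R := complex.Re `|x|.

(** The real inner product suffices for projections and for extensionality, a
    complex subspace being stable under multiplication by i; the complex one is
    recovered by [inner_rdot]. *)
Definition rdot x y : R := complex.Re (inner x y).

Lemma normE x : `|x| = (nrm x)%:C.
Proof. by rewrite /nrm RRe_real// ger0_real. Qed.

Lemma nrm_ge0 x : 0 <= nrm x.
Proof. by rewrite -ler0c -normE. Qed.

Lemma inner_nrm x : inner x x = (nrm x ^+ 2)%:C.
Proof. by rewrite inner_norm normE -rmorphXn. Qed.

Lemma rdotxx x : rdot x x = nrm x ^+ 2.
Proof. by rewrite /rdot inner_nrm. Qed.

Lemma innerC x y : inner x y = (inner y x)^*%C.
Proof. by rewrite hermC expr0 mul1r. Qed.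

Lemma rdotC x y : rdot x y = rdot y x.
Proof. by rewrite /rdot innerC; case: (inner y x). Qed.

Lemma rdotDl x y z : rdot (x + y) z = rdot x z + rdot y z.
Proof. by rewrite /rdot linearDl raddfD. Qed.

Lemma rdotNl x y : rdot (- x) y = - rdot x y.
Proof. by rewrite /rdot linearNl raddfN. Qed.

Lemma innerDl x y z : inner (x + y) z = inner x z + inner y z.
Proof. by rewrite linearDl. Qed.

Lemma innerDr x y z : inner z (x + y) = inner z x + inner z y.
Proof. by rewrite linearDr. Qed.

Lemma innerZl c x y : inner (c *: x) y = c * inner x y.
Proof. by rewrite linearZl_LR. Qed.

Lemma innerZr c x y : inner x (c *: y) = c^*%C * inner x y.
Proof. by rewrite linearZr_LR. Qed.

Lemma rdotZl a x y : rdot (a%:C *: x) y = a * rdot x y.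
Proof.
by rewrite /rdot innerZl; case: (inner x y) => p q /=; rewrite mul0r subr0.
Qed.

Lemma rdotDr x y z : rdot z (x + y) = rdot z x + rdot z y.
Proof. by rewrite rdotC rdotDl !(rdotC z). Qed.

Lemma rdotNr x y : rdot y (- x) = - rdot y x.
Proof. by rewrite rdotC rdotNl (rdotC y). Qed.

Lemma rdotZr a x y : rdot y (a%:C *: x) = a * rdot y x.
Proof. by rewrite rdotC rdotZl (rdotC y). Qed.

Lemma rdotZ c x y : rdot (c *: x) y = rdot x (c^*%C *: y).
Proof. by rewrite /rdot innerZl innerZr conjcK. Qed.

Definition rdotE := (rdotDl, rdotDr, rdotNl, rdotNr, rdotZl, rdotZr).

Lemma inner_rdot x y : inner x y = rdot x y +i* rdot x ('i *: y).
Proof.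
rewrite /rdot innerZr; case: (inner x y) => p q /=.
by rewrite mul0r mulN1r add0r opprK.
Qed.

Lemma nrm0 : nrm 0 = 0. Proof. by rewrite /nrm normr0. Qed.

Lemma nrm_eq0 x : nrm x = 0 -> x = 0.
Proof. by move=> x0; apply: normr0_eq0; rewrite normE x0. Qed.

Lemma nrm_le0 x : nrm x <= 0 -> x = 0.
Proof. by move=> x0; apply: nrm_eq0; apply/le_anti; rewrite x0 nrm_ge0. Qed.

Lemma nrmD x y : nrm (x + y) <= nrm x + nrm y.
Proof. by have := ler_normD x y; rewrite !normE -rmorphD lecR. Qed.

Lemma nrmN x : nrm (- x) = nrm x. Proof. by rewrite /nrm normrN. Qed.

Lemma nrmBC x y : nrm (x - y) = nrm (y - x).
Proof. by rewrite -nrmN opprB. Qed.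

Lemma nrm_triangle z x y : nrm (x - y) <= nrm (x - z) + nrm (z - y).
Proof. by rewrite -{1}(subrK z x) -addrA nrmD. Qed.

Lemma nrmZc c x : nrm (c *: x) = complex.Re `|c| * nrm x.
Proof.
by rewrite {1}/nrm normrZ normE; case: (`|c|) => p q /=; rewrite mulr0 subr0.
Qed.

Lemma nrmZ a x : nrm (a%:C *: x) = `|a| * nrm x.
Proof. by rewrite nrmZc normc_def /= expr0n addr0 sqrtr_sqr. Qed.

Lemma nrm_dist x y : `|nrm x - nrm y| <= nrm (x - y).
Proof.
have h u v : nrm u - nrm v <= nrm (u - v).
  by rewrite lerBlDr -{1}(subrK v u) nrmD.
by rewrite ler_norml h lerNl opprB nrmBC h.
Qed.

Lemma rdot_ext x y : (forall h, rdot h x = rdot h y) -> x = y.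
Proof.
move=> e; apply/eqP; rewrite -subr_eq0; apply/eqP/nrm_eq0/eqP.
by rewrite -sqrf_eq0 -rdotxx rdotDr rdotNr e subrr.
Qed.

(** Completeness in the form used throughout: the rate of convergence passes to
    the limit. *)
Lemma seq_complete (u : nat -> H) a :
  (forall n m, (n <= m)%N -> nrm (u m - u n) <= a * dyad R n) ->
  exists l, forall n, nrm (l - u n) <= a * dyad R n.
Proof.
move=> ue.
have /cauchy_cvg ucvg : cauchy (u @ \oo).
  apply/cauchy_ballP => t t0.
  have t0' : 0 < complex.Re t / 2.
    by move: t0; rewrite ltcE /= => /andP[_ ?]; rewrite divr_gt0.
  have [N Nt] := dyad_small a t0'.
  pose tail := [set u m | m in [set m | (N <= m)%N]].
  exists (tail, tail) => /=.
    by split; exists N => // m Nm; exists m.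
  move=> [_ _] [/= [m Nm <-] [m' Nm' <-]].
  rewrite -ball_normE /= normE.
  have : nrm (u m - u m') < complex.Re t.
    apply: le_lt_trans (nrm_triangle (u N) _ _) _; rewrite [ltRHS]splitr.
    by rewrite ltrD// ?(nrmBC (u N)); apply: le_lt_trans (ue _ _ _) Nt.
  by move=> ?; move: t0; rewrite !ltcE /= => /andP[/eqP<- _]; rewrite eqxx.
exists (lim (u @ \oo)) => n; apply/ler_addgt0Pr => t t0.
have t0' : 0 < t%:C by rewrite ltcR.
have /cvgrPdist_lt/(_ _ t0')[N _ NP] := ucvg.
have := NP (maxn N n) (leq_maxl _ _); rewrite /= normE ltcR => lt1.
apply: le_trans (nrm_triangle (u (maxn N n)) _ _) _.
by rewrite addrC lerD//; [apply: ue; rewrite leq_maxr|exact: ltW].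
Qed.

Lemma parallelogram x y :
  nrm (x + y) ^+ 2 + nrm (x - y) ^+ 2 = 2 * nrm x ^+ 2 + 2 * nrm y ^+ 2.
Proof. by rewrite -!rdotxx !rdotE (rdotC y x); lra. Qed.

Lemma closureP (A : set H) x : closure A x <->
  forall e : R, 0 < e -> exists2 y, A y & nrm (x - y) < e.
Proof.
split=> [cx e e0|h].
  have [|y [Ay]] := cx (ball x e%:C); first by apply: nbhsx_ballx; rewrite ltcR.
  by rewrite -ball_normE /= normE ltcR; exists y.
move=> B /nbhs_ballP[e /= e0 eB].
have er : e = (complex.Re e)%:C by rewrite RRe_real// gtr0_real.
have [|y Ay xy] := h (complex.Re e); first by rewrite -ltcR -er.
by exists y; split => //; apply: eB; rewrite -ball_normE /= normE er ltcR.
Qed.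

End RealStructure.

(** Polarization: the real inner product is determined by the norm, and the
    complex one by the real one. *)
Lemma isometry_inner (R : realType) (H1 H2 : hilbertType R)
    (T : boundedOp H1 H2) :
  (forall x, nrm (T x) = nrm x) -> forall x y, inner (T x) (T y) = inner x y.
Proof.
move=> Tn; have Td x y : rdot (T x) (T y) = rdot x y.
  have := rdotxx (T (x + y)); rewrite Tn -rdotxx linearD !rdotE !rdotxx !Tn.
  by rewrite (rdotC (T y)) (rdotC y); lra.
by move=> x y; rewrite !inner_rdot -linearZ !Td.
Qed.

Lemma dense_seq (R : realType) (H : hilbertType R) : separable_space H ->
  exists u : nat -> H, forall x (e : R), 0 < e -> exists n, nrm (x - u n) < e.
Proof.
case=> D /countable_injP[f fI] dD.
have /choice[u uP] n : exists x, forall y, D y -> f y = n -> x = y.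
  (* Numbers outside f @` D may be sent anywhere: only density is claimed. *)
  have [[x Dx fx]|no] := pselect (exists2 x, D x & f x = n).
    by exists x => y Dy fy; apply: fI; rewrite ?inE// fx.
  by exists 0 => y Dy fy; exfalso; apply: no; exists y.
exists u => x e e0.
have xe : ball x (e%:C)%C !=set0 by exists x; apply: ballxx; rewrite ltcR.
have [y [xy Dy]] := dD _ xe (ball_open _ _).
exists (f y); rewrite (uP (f y) y)//.
by move: xy; rewrite -ball_normE /= normE ltcR.
Qed.

(** * Orthogonal projection onto a closed subspace *)

Section Projection.
Variables (R : realType) (H : hilbertType R) (K : closedSubspace H).
Implicit Types (x y k u : H).
Local Open Scope complex_scope.

Lemma closedSubspace_limit x :
  (forall e : R, 0 < e -> exists2 y, y \in K & nrm (x - y) < e) -> x \in K.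
Proof. by move=> h; apply: (cs_closed (c := K)); apply/closureP. Qed.

(** If v had a component along u, subtracting a small multiple of u would
    shorten v. *)
Lemma orth_of_min v u :
  (forall t : R, nrm v ^+ 2 <= nrm (v - t%:C *: u) ^+ 2) -> rdot v u = 0.
Proof.
(* The optimal multiple is rdot v u / nrm u ^+ 2; adding 1 to the denominator
   keeps it nonzero and t is still small enough. *)
pose t := rdot v u / (nrm u ^+ 2 + 1).
have q0 : 0 <= nrm u ^+ 2 by exact: sqr_ge0.
have tq : rdot v u = t * (nrm u ^+ 2 + 1).
  by rewrite /t divfK// gt_eqF// ltr_pwDr.
move=> /(_ t); rewrite -!rdotxx !rdotE (rdotC u v) (rdotxx u) tq.
move: (nrm u ^+ 2) q0 t {tq} => q q0 t.
have [->|t0] := eqVneq t 0; first by move=> _; rewrite mul0r.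
have : 0 < t ^+ 2 by rewrite lt0r sqrf_eq0 t0 sqr_ge0.
by nra.
Qed.

(** Parallelogram argument: vectors of K at almost minimal distance from x form
    a Cauchy sequence, since their midpoints also lie in K. *)
Lemma orthoproj_ex x :
  exists2 k, k \in K & forall u, u \in K -> rdot (x - k) u = 0.
Proof.
pose D := [set nrm (x - k) ^+ 2 | k in [set k | k \in K]].
have D0 : D !=set0 by exists (nrm (x - 0) ^+ 2), 0 => //=; exact: rpred0.
have lbD : lbound D 0 by move=> _ [k _ <-]; exact: sqr_ge0.
have infD : has_inf D by split => //; exists 0.
have dP k : k \in K -> inf D <= nrm (x - k) ^+ 2.
  by move=> kK; apply: ge_inf; [exists 0|exists k].
have d_ge0 : 0 <= inf D by exact: lb_le_inf.
have /choice[k kP] n : exists k,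
    k \in K /\ nrm (x - k) ^+ 2 < inf D + dyad R n ^+ 2.
  have [|_ [k kK <-] kd] := @inf_adherent _ _ (dyad R n ^+ 2 : R) _ infD.
    by rewrite exprn_gt0// dyad_gt0.
  by exists k.
have [n m nm|l lP] := @seq_complete _ _ k 2.
- have hn : 0 < dyad R n by exact: dyad_gt0.
  have hm : 0 < dyad R m by exact: dyad_gt0.
  have mn := le_dyad R nm.
  rewrite -(@ler_pXn2r _ 2)// ?nnegrE ?nrm_ge0 ?mulr_ge0 ?(ltW hn)//.
  have := parallelogram (x - k n) (x - k m).
  have -> : x - k n - (x - k m) = k m - k n by rewrite opprB addrC addrA subrK.
  have mid : 2^-1%:C *: (k n + k m) \in K.
    by apply: rpredZ; apply: rpredD; [have [] := kP n|have [] := kP m].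
  have := dP _ mid.
  have -> : x - k n + (x - k m) = 2%:C *: (x - 2^-1%:C *: (k n + k m)).
    rewrite scalerBr scalerA -rmorphM divff// scale1r.
    have -> : 2%:C = 1 + 1 :> R[i].
      by rewrite -[1 in RHS](rmorph1 (real_complex R)) -rmorphD.
    by rewrite scalerDl !scale1r addrACA opprD.
  (* The left-hand side of the parallelogram law is now 4 times the squared
     distance from x to the midpoint, which is at least 4 inf D. *)
  rewrite nrmZ ger0_norm// exprMn.
  have [_ nP] := kP n; have [_ mP] := kP m.
  by move: nP mP hn hm mn; set a := nrm _; set b := nrm _; set p := dyad R n;
    set q := dyad R m; set c := nrm _; set d := nrm _; nra.
- have lK : l \in K.
    apply: closedSubspace_limit => e e0; have [N Ne] := dyad_small 2 e0.
    by exists (k N); [have [] := kP N|exact: le_lt_trans (lP N) Ne].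
  exists l => // u uK.
  have xl : nrm (x - l) ^+ 2 <= inf D.
    rewrite -[leRHS]sqr_sqrtr// ler_pXn2r ?nnegrE ?nrm_ge0 ?sqrtr_ge0//.
    apply: (@ler_dyad _ _ _ 3) => n; apply: le_trans (nrm_triangle (k n) _ _) _.
    have hn : 0 < dyad R n by exact: dyad_gt0.
    have : nrm (x - k n) <= Num.sqrt (inf D) + dyad R n.
      rewrite -(@ler_pXn2r _ 2)// ?nnegrE ?nrm_ge0//;
        last by rewrite addr_ge0 ?sqrtr_ge0 ?(ltW hn).
      have [_ /ltW/le_trans->//] := kP n.
      rewrite sqrrD sqr_sqrtr// lerD2r lerDl.
      by rewrite mulrn_wge0 ?mulr_ge0 ?sqrtr_ge0 ?(ltW hn).
    by have := lP n; rewrite (nrmBC l); lra.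
  apply: orth_of_min => t; apply: (le_trans xl).
  by rewrite -addrA -opprD; apply: dP; apply: rpredD => //; exact: rpredZ.
Qed.

Definition orthoproj x := s2val (cid2 (orthoproj_ex x)).

Lemma orthoproj_mem x : orthoproj x \in K.
Proof. by rewrite /orthoproj; case: cid2. Qed.

Lemma orthoproj_orth x u : u \in K -> rdot (x - orthoproj x) u = 0.
Proof. by rewrite /orthoproj; case: cid2 => /= k _; exact. Qed.

Lemma orthoproj_uniq x k : k \in K ->
  (forall u, u \in K -> rdot (x - k) u = 0) -> orthoproj x = k.
Proof.
move=> kK ko; apply/eqP; rewrite -subr_eq0; apply/eqP/nrm_eq0/eqP.
have dK : orthoproj x - k \in K by apply: rpredB => //; exact: orthoproj_mem.
rewrite -sqrf_eq0 -rdotxx.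
have {1}-> : orthoproj x - k = (x - k) - (x - orthoproj x).
  by rewrite [RHS]addrC opprB addrA subrK.
by rewrite rdotDl rdotNl ko// orthoproj_orth// subr0.
Qed.

Lemma orthoproj_id k : k \in K -> orthoproj k = k.
Proof.
move=> kK; apply: orthoproj_uniq => // u _.
by rewrite subrr -(scale0r 0) rdotZl mul0r.
Qed.

Lemma orthoproj_linear : linear orthoproj.
Proof.
move=> c x y; apply: orthoproj_uniq.
  by rewrite rpredD ?rpredZ ?orthoproj_mem.
move=> u uK; have -> : c *: x + y - (c *: orthoproj x + orthoproj y) =
    c *: (x - orthoproj x) + (y - orthoproj y).
  by rewrite scalerBr opprD addrACA.
by rewrite rdotDl rdotZ !orthoproj_orth ?addr0// rpredZ.
Qed.

Lemma nrm_orthoproj x : nrm (orthoproj x) <= nrm x.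
Proof.
rewrite -(@ler_pXn2r _ 2)// ?nnegrE ?nrm_ge0// -!rdotxx.
have h := orthoproj_orth x (orthoproj_mem x).
move: h (subrK (orthoproj x) x).
move: (x - orthoproj x) => v; move: (orthoproj x) => p vp <-.
rewrite rdotDl !rdotDr (rdotC p v) vp addr0 add0r lerDr rdotxx.
exact: sqr_ge0.
Qed.

End Projection.

(** * Spectral measures and their scalar measures *)

Section SpectralBasics.
Context (R : realType) d (X : measurableType d) (H : hilbertType R).
Variable pi : spectralMeasure X H.
Implicit Types (A B : set X) (h k x : H).
Local Open Scope complex_scope.

Lemma sm_sigma h k (F : (set X)^nat) : (forall n, measurable (F n)) ->
  trivIset setT F ->
  (fun n => \sum_(0 <= i < n) rdot h (pi (F i) k)) @ \oo
    --> rdot h (pi (\bigcup_n F n) k).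
Proof.
move=> mF tF; have := Re_cvg (@sm_measure _ _ _ _ pi h k F mF tF).
by under eq_fun do rewrite raddf_sum.
Qed.

Lemma sm_idem A x : measurable A -> pi A (pi A x) = pi A x.
Proof. by move=> mA; have [->] := sm_projection pi mA. Qed.

Lemma sm_sym A x y : measurable A -> rdot (pi A x) y = rdot x (pi A y).
Proof. by move=> mA; have [_ e] := sm_projection pi mA; rewrite /rdot e. Qed.

(** The scalar measure of h, usually written A |-> <h, pi(A) h>; as a squared
    norm it is nonnegative for every A, measurable or not. *)
Definition weight h A : R := nrm (pi A h) ^+ 2.

Lemma weightE h A : measurable A -> weight h A = rdot h (pi A h).
Proof. by move=> mA; rewrite /weight -rdotxx sm_sym// sm_idem. Qed.

Lemma weight_ge0 h A : 0 <= weight h A. Proof. exact: sqr_ge0. Qed.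

Lemma weight_eq0 h A : weight h A = 0 -> pi A h = 0.
Proof. by move=> /eqP; rewrite sqrf_eq0 => /eqP/nrm_eq0. Qed.

(** The constant series of terms |pi(set0) x|^2 converges, so its term is 0. *)
Lemma sm_set0 x : pi set0 x = 0.
Proof.
apply: weight_eq0; rewrite weightE//.
have t0 : trivIset setT (fun _ : nat => @set0 X) by move=> i j _ _ [t []].
have := @sm_sigma x x (fun=> set0) (fun=> measurable0) t0.
move=> /cvgP/cvg_series_cvg_0/cvg_lim <-//.
by rewrite lim_cst.
Qed.

Lemma sm_setU A B x : measurable A -> measurable B -> A `&` B = set0 ->
  pi (A `|` B) x = pi A x + pi B x.
Proof.
move=> mA mB AB; apply: rdot_ext => h.
have mF n : measurable (bigcup2 A B n) by case: n => [|[|n]] //=.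
have := @sm_sigma h x (bigcup2 A B) mF.
rewrite -trivIset_bigcup2 bigcup2E => /(_ AB)/cvg_lim <-//.
apply: lim_near_cst => //; exists 2%N => // -[|[|n]]//= _.
rewrite !big_nat_recl//= big1 ?addr0 ?rdotDr// => i _.
by rewrite sm_set0 -(scale0r 0) rdotZr mul0r.
Qed.

Lemma nrm_sm h A : measurable A -> nrm (pi A h) <= nrm h.
Proof.
move=> mA; rewrite -(@ler_pXn2r _ 2)// ?nnegrE ?nrm_ge0//.
rewrite -/(weight h A) weightE//.
have : 0 <= rdot (h - pi A h) (h - pi A h) by rewrite rdotxx sqr_ge0.
rewrite !rdotE rdotxx (rdotC _ h) sm_sym// sm_idem//.
by lra.
Qed.

(** For y = pi(B) x, additivity on the disjoint sets A and B gives
    |pi(A) y|^2 + |y|^2 <= |y|^2. *)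
Lemma sm_setI0 A B x : measurable A -> measurable B -> A `&` B = set0 ->
  pi A (pi B x) = 0.
Proof.
move=> mA mB AB; apply: weight_eq0; apply/le_anti; rewrite weight_ge0 andbT.
have mU : measurable (A `|` B) by exact: measurableU.
have := nrm_sm (pi B x) mU; rewrite -(@ler_pXn2r _ 2)// ?nnegrE ?nrm_ge0//.
rewrite -/(weight _ _) weightE// sm_setU// rdotDr sm_idem// -weightE// rdotxx.
by lra.
Qed.

Lemma sm_split A B x : measurable A -> measurable B ->
  pi A x = pi (A `&` B) x + pi (A `\` B) x.
Proof.
move=> mA mB; rewrite -{1}(setUIDK A B) sm_setU//; first exact: measurableI.
  exact: measurableD.
by rewrite setDE setIACA setICr setI0.
Qed.

Lemma sm_setI A B x : measurable A -> measurable B ->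
  pi A (pi B x) = pi (A `&` B) x.
Proof.
move=> mA mB; have mI : measurable (A `&` B) by exact: measurableI.
have mBA : measurable (B `\` A) by exact: measurableD.
have mAB : measurable (A `\` B) by exact: measurableD.
have e1 : pi A (pi B x) = pi A (pi (A `&` B) x).
  rewrite (sm_split x mB mA) linearD/= (setIC B) (sm_setI0 x mA mBA) ?addr0//.
  by rewrite setDE setICA setICr setI0.
rewrite e1 (sm_split _ mA mB) sm_idem// sm_setI0// ?addr0//.
by rewrite setDE setIACA (setIC _ B) setICr setI0.
Qed.

Lemma sm_setC A x : measurable A -> x = pi A x + pi (~` A) x.
Proof.
move=> mA.
by rewrite -{1}(sm_total pi x) (sm_split x measurableT mA) setTI setTD.
Qed.

Lemma weight_split h A B : measurable A -> measurable B ->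
  weight h A = weight h (A `&` B) + weight h (A `\` B).
Proof.
move=> mA mB; have mI : measurable (A `&` B) by exact: measurableI.
have mAB : measurable (A `\` B) by exact: measurableD.
by rewrite !weightE// (sm_split h mA mB) rdotDr.
Qed.

Lemma weight_sm h A B : measurable A -> measurable B ->
  weight (pi B h) A = weight h (A `&` B).
Proof. by move=> mA mB; rewrite /weight sm_setI. Qed.

Lemma weightZ (a : R) h A : weight (a%:C *: h) A = a ^+ 2 * weight h A.
Proof. by rewrite /weight linearZ/= nrmZ exprMn real_normK ?num_real. Qed.

Lemma sm_bigcup0 h (F : (set X)^nat) : (forall n, measurable (F n)) ->
  (forall n, pi (F n) h = 0) -> pi (\bigcup_n F n) h = 0.
Proof.
move=> mF F0; rewrite seqDU_bigcup_eq; apply: rdot_ext => k.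
have mD n : measurable (seqDU F n).
  by apply: measurableD => //; apply: bigsetU_measurable => i _; exact: mF.
have D0 n : pi (seqDU F n) h = 0.
  by rewrite -(setIidl (subset_seqDU (A := F) (i := n))) -sm_setI// F0 linear0.
have := @sm_sigma k h (seqDU F) mD (@trivIset_seqDU _ F).
move=> /cvg_lim <-//; apply: lim_near_cst => //; apply: nearW => n.
have r0 : rdot k 0 = 0 by rewrite -(scale0r 0) rdotZr mul0r.
by rewrite big1 ?r0// => i _; rewrite D0 r0.
Qed.

(** The inner products between the vectors pi(A) x depend only on the weight
    of x, which is why equal weights give isometric cyclic subspaces. *)
Lemma inner_sm x A B : measurable A -> measurable B ->
  inner (pi A x) (pi B x) = (weight x (A `&` B))%:C.
Proof.
move=> mA mB; have mI : measurable (A `&` B) by exact: measurableI.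
have sa C y z : measurable C -> inner (pi C y) z = inner y (pi C z).
  by move=> mC; have [_] := sm_projection pi mC.
by rewrite /weight -inner_nrm !sa// sm_setI// sm_idem.
Qed.

Lemma dense_null (u : nat -> H) A :
  (forall x (e : R), 0 < e -> exists n, nrm (x - u n) < e) -> measurable A ->
  (forall n, pi A (u n) = 0) -> forall x, pi A x = 0.
Proof.
move=> du mA Au x; apply: nrm_le0; apply/ler_addgt0Pr => e e0.
rewrite add0r; have [n xn] := du x e e0.
rewrite -[pi A x]subr0 -(Au n) -linearB/=.
exact: le_trans (nrm_sm _ mA) (ltW xn).
Qed.

End SpectralBasics.

(** * A vector whose scalar measure has a prescribed density *)

Section Weights.
Context (R : realType) d (X : measurableType d) (H1 H2 : hilbertType R).
Variables (pi1 : spectralMeasure X H1) (pi2 : spectralMeasure X H2).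
Implicit Types (A B : set X) (C c : R).
Local Open Scope complex_scope.

Section Hahn.
Variables (h : H1) (k : H2).

Definition weight_diff A : \bar R := (weight pi2 k A - weight pi1 h A)%:E.

Let weight_diff0 : weight_diff set0 = 0%E.
Proof. by rewrite /weight_diff /weight !sm_set0 !nrm0 subrr. Qed.

Let weight_diff_fin A : measurable A -> weight_diff A \is a fin_num.
Proof. by []. Qed.

Let weight_diff_sigma : semi_sigma_additive weight_diff.
Proof.
move=> F mF tF mUF; rewrite /weight_diff.
under eq_fun do rewrite sumEFin.
apply: cvg_EFin; first exact: nearW.
rewrite /comp /= !weightE//.
under eq_fun => n do
  [under eq_bigr => i _ do rewrite !weightE//; rewrite sumrB].
by apply: cvgB; exact: sm_sigma.
Qed.

HB.instance Definition _ :=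
  isCharge.Build _ X R weight_diff
    weight_diff0 weight_diff_fin weight_diff_sigma.

Lemma hahn_weight : exists P, [/\ measurable P,
  forall A, measurable A -> A `<=` P -> weight pi1 h A <= weight pi2 k A &
  forall A, measurable A -> A `<=` ~` P -> weight pi2 k A <= weight pi1 h A].
Proof.
have [P [N [[mP Ppos] [mN Nneg] PN PN0]]] := Hahn_decomposition weight_diff.
exists P; split => // A mA AP.
  by have := Ppos A mA AP; rewrite lee_fin subr_ge0.
have /(Nneg A mA) : A `<=` N.
  by move=> x /AP Px; by have [] : (P `|` N) x by rewrite PN.
by rewrite lee_fin subr_le0.
Qed.

End Hahn.

Definition weight_between C (h : H1) (k : H2) := forall A, measurable A ->
  weight pi1 h A <= weight pi2 k A <= C * weight pi1 h A.

(** Multiplying h by c on the positive set B of weight k - c^2 weight h keeps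
    its weight below that of k.  On B the ratio of the weights drops from c^4 to
    c^2; off B it was at most c^2 by the choice of B. *)
Lemma weight_between_step c h k : 1 <= c -> weight_between (c ^+ 4) h k ->
  exists h', nrm (h' - h) <= (c - 1) * nrm k /\ weight_between (c ^+ 2) h' k.
Proof.
move=> c1 hk; have [B [mB Bpos Bneg]] := hahn_weight (c%:C *: h) k.
exists (h + (c - 1)%:C *: pi1 B h).
have c0 : 0 <= c - 1 by rewrite subr_ge0.
split.
  rewrite addrC addKr nrmZ ger0_norm// ler_wpM2l//.
  rewrite -(@ler_pXn2r _ 2)// ?nnegrE ?nrm_ge0//.
  have /andP[/le_trans hB _] := hk B mB; apply: hB.
  by rewrite /weight ler_pXn2r ?nnegrE ?nrm_ge0// nrm_sm.
move=> A mA; set h' := _ + _.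
have mI : measurable (A `&` B) by exact: measurableI.
have mD : measurable (A `\` B) by exact: measurableD.
have e1 : weight pi1 h' (A `&` B) = c ^+ 2 * weight pi1 h (A `&` B).
  rewrite -weightZ /weight /h' !linearD !linearZ/= sm_setI// -setIA setIid.
  rewrite -{1}(scale1r (pi1 _ _)) -scalerDl.
  by rewrite -[1](rmorph1 (real_complex R)) -rmorphD addrC subrK.
have e2 : weight pi1 h' (A `\` B) = weight pi1 h (A `\` B).
  rewrite /weight /h' !linearD !linearZ/= sm_setI0// ?scaler0 ?addr0//.
  by rewrite setDE -setIA (setIC _ B) setICr setI0.
rewrite !(weight_split _ _ mA mB) ?e1 ?e2.
have /andP[_ kI] := hk _ mI; have /andP[hD _] := hk _ mD.
have := Bpos _ mI (@subIsetr _ _ _); have := Bneg _ mD (@subIsetr _ _ _).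
rewrite !weightZ.
have := weight_ge0 pi1 h (A `&` B); have := weight_ge0 pi1 h (A `\` B).
rewrite (exprD c 2 2) in kI.
by move: kI hD; lra.
Qed.

Lemma weight_between_sqrt C h k : 1 <= C -> weight_between C h k ->
  exists h', nrm (h' - h) <= (Num.sqrt C - 1) * nrm k /\
             weight_between (Num.sqrt C) h' k.
Proof.
move=> C1 hk; have sC1 : 1 <= Num.sqrt C by rewrite -[1]sqrtr1 ler_wsqrtr.
have ssC1 : 1 <= Num.sqrt (Num.sqrt C) by rewrite -[1]sqrtr1 ler_wsqrtr.
have s0 : 0 <= Num.sqrt C by exact: le_trans sC1.
have C0 : 0 <= C by exact: le_trans C1.
have [|h' [d1 d2]] := @weight_between_step (Num.sqrt (Num.sqrt C)) h k ssC1.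
  by rewrite (exprM _ 2 2) !sqr_sqrtr.
rewrite sqr_sqrtr// in d2.
exists h'; split => //; apply: le_trans d1 _.
rewrite ler_wpM2r ?nrm_ge0// lerD2r -[leRHS](sqr_sqrtr s0) expr2.
by rewrite ler_peMl// (le_trans _ ssC1).
Qed.

(** sqrt t - 1 = (t - 1) / (sqrt t + 1) is at most (t - 1) / 2 for t >= 1. *)
Lemma iter_sqrt_dyad C n : 1 <= C ->
  1 <= iter n Num.sqrt C <= 1 + (C - 1) * dyad R n.
Proof.
move=> C1; elim: n => [|n /andP[h1 h2]].
  by rewrite /dyad /= mulr1 addrC subrK C1 lexx.
rewrite iterS dyadS; set t := iter n _ C in h1 h2 *.
have s1 : 1 <= Num.sqrt t by rewrite -[1]sqrtr1 ler_wsqrtr.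
have : Num.sqrt t ^+ 2 = t by rewrite sqr_sqrtr// (le_trans _ h1).
by rewrite s1 /=; move: (Num.sqrt t) s1 h1 h2 => s; nra.
Qed.

(** The lower bound of [weight_between] keeps all the approximating vectors at
    norm at most |k|; with the dyadic decay of the constants, the steps of
    [weight_between_sqrt] are summable. *)
Lemma ex_equal_weight C h k : 1 <= C -> weight_between C h k ->
  exists h', forall A, measurable A -> weight pi1 h' A = weight pi2 k A.
Proof.
move=> C1 hk; pose Cn n := iter n Num.sqrt C.
have Cn1 n : 1 <= Cn n by have /andP[] := iter_sqrt_dyad n C1.
(* Where the hypothesis on p fails, the value 0 is a dummy that the sequence u
   never meets. *)
have /choice[f fP] (p : nat * H1) : exists h', weight_between (Cn p.1) p.2 k ->
    nrm (h' - p.2) <= (Cn p.1.+1 - 1) * nrm k /\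
    weight_between (Cn p.1.+1) h' k.
  case: p => n g /=; have [b|nb] := pselect (weight_between (Cn n) g k).
    by have [h' hP] := weight_between_sqrt (Cn1 n) b; exists h'.
  by exists 0.
pose u := fix u n := if n is m.+1 then f (m, u m) else h.
have uP n : weight_between (Cn n) (u n) k by elim: n => [//|n /(fP (n, u n))[]].
pose D := (C - 1) * nrm k.
have D0 : 0 <= D by rewrite mulr_ge0 ?nrm_ge0 ?subr_ge0.
have uD n : nrm (u n.+1 - u n) <= D * dyad R n.+1.
  have [/le_trans-> //] := fP (n, u n) (uP n).
  rewrite /D mulrAC ler_wpM2r ?nrm_ge0// lerBlDl.
  by have /andP[] := iter_sqrt_dyad n.+1 C1.
have [n m /subnKC <-|l lP] := @seq_complete _ _ u D.
  suff : nrm (u (n + (m - n))%N - u n) <=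
      D * dyad R n - D * dyad R (n + (m - n)).
    by move=> /le_trans->//; rewrite gerBl mulr_ge0// ltW// dyad_gt0.
  elim: (m - n)%N => [|q IH]; first by rewrite addn0 !subrr nrm0.
  apply: le_trans (nrm_triangle (u (n + q)%N) _ _) _.
  apply: le_trans (lerD _ IH) _; first by rewrite addnS; exact: uD.
  by rewrite addnS dyadS; lra.
exists l => A mA.
have near n : `|nrm (pi1 A l) - nrm (pi1 A (u n))| <= D * dyad R n.
  apply: le_trans (nrm_dist _ _) _; rewrite -linearB/=.
  exact: le_trans (nrm_sm _ _ mA) (lP n).
rewrite /weight; set a := nrm (pi1 A l) in near *; set b := nrm _.
have a0 : 0 <= a by exact: nrm_ge0.
have b0 : 0 <= b by exact: nrm_ge0.
have unb n : nrm (pi1 A (u n)) <= b.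
  have /andP[+ _] := uP n A mA.
  by rewrite /weight ler_pXn2r ?nnegrE ?nrm_ge0.
apply/le_anti/andP; split.
  rewrite ler_pXn2r ?nnegrE//; apply: (@ler_dyad _ _ _ D) => n.
  have := near n; rewrite ler_norml => /andP[_].
  by rewrite lerBlDr => /le_trans->//; rewrite addrC lerD2r.
(* With t = dyad n <= 1 and v = |pi1(A) u_n|: v <= a + D t gives the first two
   terms, Cn n <= 1 + (C - 1) t and v <= b give the third. *)
apply: (@ler_dyad _ _ _ (2 * a * D + D ^+ 2 + (C - 1) * b ^+ 2)) => n.
have /andP[_] := uP n A mA; rewrite /weight -/b.
have /andP[_ Cnb] := iter_sqrt_dyad n C1; rewrite -/(Cn n) in Cnb.
have := near n; rewrite ler_norml => /andP[+ _].
have := unb n; have := nrm_ge0 (pi1 A (u n)).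
have := dyad_gt0 R n; have := dyad_le1 R n.
set v := nrm _; set t := dyad R n in Cnb *; move=> t1 t0 v0 vb av bC.
have va : v <= a + D * t by lra.
have h1 : v ^+ 2 <= (a + D * t) ^+ 2.
  by rewrite ler_pXn2r ?nnegrE// addr_ge0// mulr_ge0// ltW.
have h2 : Cn n * v ^+ 2 <= v ^+ 2 + (C - 1) * t * b ^+ 2.
  have h3 : v ^+ 2 <= b ^+ 2 by rewrite ler_pXn2r ?nnegrE.
  have h4 : Cn n * v ^+ 2 <= (1 + (C - 1) * t) * v ^+ 2.
    by rewrite ler_wpM2r ?sqr_ge0.
  apply: le_trans h4 _; rewrite mulrDl mul1r lerD2l ler_wpM2l//.
  by rewrite mulr_ge0 ?subr_ge0// ltW.
have h5 : D ^+ 2 * t ^+ 2 <= D ^+ 2 * t.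
  by rewrite ler_wpM2l ?sqr_ge0// expr2 ler_piMl// ltW.
apply: le_trans bC _; apply: le_trans h2 _.
by move: h1 h5; rewrite sqrrD exprMn; lra.
Qed.

End Weights.

(** * Separating pairs of vectors and mutual singularity *)

Section Separation.
Context (R : realType) d (X : measurableType d).
Implicit Types (A B : set X) (c : R).
Local Open Scope complex_scope.

(** Let P n be a positive set of weight k - 4^n weight h.  On the intersection
    of all P n, weight h is at most 4^-n weight k for every n, hence 0; on the
    complement N n of P n the domination holds by the choice of P n. *)
Lemma hahn_exhaust (H1 H2 : hilbertType R) (pi1 : spectralMeasure X H1)
    (pi2 : spectralMeasure X H2) (h : H1) (k : H2) :
  exists N : nat -> set X, [/\ forall n, measurable (N n),
    pi1 (~` \bigcup_n N n) h = 0 &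
    forall n, exists2 c, 1 <= c & forall A, measurable A -> A `<=` N n ->
      weight pi2 k A <= c ^+ 2 * weight pi1 h A].
Proof.
pose c n := (dyad R n)^-1.
have /choice[P PP] n := hahn_weight pi1 pi2 ((c n)%:C *: h) k.
have mP n : measurable (P n) by have [] := PP n.
exists (fun n => ~` P n); split => [n||n].
- exact: measurableC.
- rewrite -setC_bigcap setCK; have mS : measurable (\bigcap_n P n).
    exact: bigcapT_measurable.
  apply: weight_eq0; apply/le_anti; rewrite weight_ge0 andbT.
  apply: (@ler_dyad _ _ _ (weight pi2 k (\bigcap_n P n))) => n.
  have [_ + _] := PP n => /(_ _ mS (bigcap_inf I)); rewrite weightZ add0r.
  rewrite exprVn mulrC ler_pdivrMr ?exprn_gt0 ?dyad_gt0// => /le_trans; apply.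
  rewrite ler_wpM2l ?weight_ge0// expr2 ler_piMl ?dyad_le1//.
  exact/ltW/dyad_gt0.
- exists (c n); first by rewrite invf_ge1 ?dyad_gt0// dyad_le1.
  by have [_ _ PN] := PP n => A mA /(PN A mA); rewrite weightZ.
Qed.

Variables (H1 H2 : hilbertType R).
Variables (pi1 : spectralMeasure X H1) (pi2 : spectralMeasure X H2).

Hypothesis no_equal_weight : forall h k,
  (forall A, measurable A -> weight pi1 h A = weight pi2 k A) -> k = 0.

(** After restriction to E and scaling of h by 1/c', the two weights satisfy the
    hypotheses of [ex_equal_weight], and equal weights force pi2(E) k = 0. *)
Lemma comparable_null h k E (c c' : R) : 1 <= c -> 1 <= c' -> measurable E ->
  (forall A, measurable A -> A `<=` E ->
    weight pi2 k A <= c ^+ 2 * weight pi1 h A) ->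
  (forall A, measurable A -> A `<=` E ->
    weight pi1 h A <= c' ^+ 2 * weight pi2 k A) ->
  pi2 E k = 0.
Proof.
move=> c1 c'1 mE kh hk.
have c'0 : 0 < c' by exact: lt_le_trans c'1.
have [||h' h'P] := @ex_equal_weight _ _ _ _ _ pi1 pi2 ((c * c') ^+ 2)
  (c'^-1%:C *: pi1 E h) (pi2 E k).
- by rewrite exprn_ege1// mulr_ege1.
- move=> A mA; rewrite weightZ !weight_sm// exprMn exprVn.
  have mI : measurable (A `&` E) by exact: measurableI.
  have := kh _ mI (@subIsetr _ _ _); have := hk _ mI (@subIsetr _ _ _).
  rewrite -[c ^+ 2 * _ * _]mulrA mulVKf ?expf_neq0 ?gt_eqF// => hA ->.
  by rewrite mulrC ler_pdivrMr ?exprn_gt0// mulrC hA.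
- exact: no_equal_weight h'P.
Qed.

(** The sets N n exhaust X up to a null set of h and the sets M m exhaust X up
    to a null set of k; on each N n cap M m the weights are comparable, so k
    vanishes there.  Hence k vanishes on the union of the N n. *)
Lemma separate_pair h k :
  exists S, [/\ measurable S, pi1 S h = 0 & pi2 (~` S) k = 0].
Proof.
have [N [mN N0 Nc]] := hahn_exhaust pi1 pi2 h k.
have [M [mM M0 Mc]] := hahn_exhaust pi2 pi1 k h.
have mUM : measurable (\bigcup_n M n) by exact: bigcupT_measurable.
exists (~` \bigcup_n N n); split => //.
  exact/measurableC/bigcupT_measurable.
rewrite setCK; apply: sm_bigcup0 => // n.
rewrite (sm_setC pi2 (pi2 (N n) k) mUM) sm_bigcup0// ?add0r => [|m].
  rewrite sm_setI//; last exact: measurableC.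
  by rewrite setIC -sm_setI// ?M0 ?linear0//; exact: measurableC.
rewrite sm_setI//.
have [c c1 cP] := Nc n; have [c' c'1 c'P] := Mc m.
apply: (comparable_null (h := h) c1 c'1); first exact: measurableI.
- by move=> A mA /subset_trans-/(_ _ (@subIsetr _ _ _)) AN; exact: cP.
- by move=> A mA /subset_trans-/(_ _ (@subIsetl _ _ _)) AM; exact: c'P.
Qed.

(** With S (n, m) separating u n from v m, the union over m of the intersections
    over n of the S (n, m) is null for every u n, and its complement is null for
    every v m. *)
Lemma separated_singular : separable_space H1 -> separable_space H2 ->
  mutually_singular pi1 pi2.
Proof.
move=> /dense_seq[u du] /dense_seq[v dv].
have /choice[S SP] (p : nat * nat) := separate_pair (u p.1) (v p.2).
have mS p : measurable (S p) by have [] := SP p.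
pose Y := \bigcup_m \bigcap_n S (n, m).
have mY : measurable Y.
  by apply: bigcupT_measurable => m; exact: bigcapT_measurable.
have mYC : measurable (~` Y) by exact: measurableC.
have Y1 x : pi1 Y x = 0.
  apply: (dense_null du) => // n; apply: sm_bigcup0 => m.
    exact: bigcapT_measurable.
  have [_ S0 _] := SP (n, m).
  have mI : measurable (\bigcap_n S (n, m)) by exact: bigcapT_measurable.
  have sub : \bigcap_n S (n, m) `<=` S (n, m) by exact: bigcap_inf.
  by rewrite -(setIidl sub) -sm_setI// S0 linear0.
have Y2 x : pi2 (~` Y) x = 0.
  apply: (dense_null dv) => // m.
  have sub : ~` Y `<=` \bigcup_n ~` S (n, m).
    by rewrite -setC_bigcap; apply: subsetC => t; exists m.
  rewrite -(setIidl sub) -sm_setI//; last first.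
    by apply: bigcupT_measurable => n; exact: measurableC.
  rewrite sm_bigcup0 ?linear0// => n; first exact: measurableC.
  by have [] := SP (n, m).
exists (~` Y), Y; split => //; first by rewrite setICl.
move=> A mA; split => x.
  rewrite (sm_split pi1 x mA mYC) [X in _ + X = _](_ : _ = 0) ?addr0//.
  by rewrite setDE setCK -sm_setI// Y1 linear0.
rewrite (sm_split pi2 x mA mY) [X in _ + X = _](_ : _ = 0) ?addr0//.
by rewrite setDE -sm_setI// Y2 linear0.
Qed.

End Separation.

(** * Unitary equivalence of cyclic sub-spectral measures *)

Section GraphDomain.
Variables (R : realType) (H1 H2 : hilbertType R) (G : H1 -> H2 -> Prop).
Local Open Scope complex_scope.

(** An isometry between closed subspaces, described by its graph: the domain and
    the range then play symmetric roles, and closing the graph replaces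
    the extension of an isometry by continuity. *)
Definition isometric_graph :=
  [/\ G 0 0,
      forall (c : R[i]) x y x' y', G x y -> G x' y' ->
        G (c *: x + x') (c *: y + y'),
      forall x y, G x y -> nrm x = nrm y &
      forall x y, (forall e : R, 0 < e -> exists x' y',
        [/\ G x' y', nrm (x - x') < e & nrm (y - y') < e]) -> G x y].

Hypothesis isoG : isometric_graph.

Definition graph_dom : {pred H1} := [pred x | `[< exists y, G x y >]].

Lemma graph_domP x : reflect (exists y, G x y) (x \in graph_dom).
Proof. exact: asboolP. Qed.

Lemma graphB x y x' y' : G x y -> G x' y' -> G (x - x') (y - y').
Proof.
case: isoG => _ GL _ _ Gxy Gxy'.
by have := GL (-1) _ _ _ _ Gxy' Gxy; rewrite !scaleN1r ![- _ + _]addrC.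
Qed.

Lemma graph_uniq x y y' : G x y -> G x y' -> y = y'.
Proof.
case: isoG => _ _ Gn _ Gxy Gxy'.
apply/eqP; rewrite -subr_eq0; apply/eqP/nrm_eq0.
by rewrite -(Gn _ _ (graphB Gxy Gxy')) subrr nrm0.
Qed.

Lemma graph_dom_submod : submod_closed graph_dom.
Proof.
case: isoG => G0 GL _ _; split; first by apply/graph_domP; exists 0.
move=> c x x' /graph_domP[y Gxy] /graph_domP[y' Gxy'].
by apply/graph_domP; exists (c *: y + y'); exact: GL.
Qed.

(** The images of a Cauchy sequence under an isometry form a Cauchy sequence,
    and the graph is closed. *)
Lemma graph_dom_closed : closed [set x | x \in graph_dom].
Proof.
case: isoG => G0 GL Gn Gcl x /closureP cx; apply/graph_domP.
have /choice[p pP] n : exists p : H1 * H2,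
    G p.1 p.2 /\ nrm (x - p.1) < dyad R n.
  have [x' /graph_domP[y Gxy] xx'] := cx _ (dyad_gt0 R n).
  by exists (x', y).
have pG n : G (p n).1 (p n).2 by have [] := pP n.
have px n : nrm (x - (p n).1) < dyad R n by have [] := pP n.
have [n m nm|l lP] := @seq_complete _ _ (fun n => (p n).2) 2.
  rewrite -(Gn _ _ (graphB (pG m) (pG n))).
  apply: le_trans (nrm_triangle x _ _) _; rewrite (nrmBC _ x).
  have := px n; have := px m; have := le_dyad R nm.
  by move: (nrm _) (nrm _) => a b; lra.
exists l; apply: Gcl => e e0; have [n ne] := dyad_small 2 e0.
exists (p n).1, (p n).2; split => //; last exact: le_lt_trans (lP n) ne.
apply: lt_trans (px n) _; apply: le_lt_trans ne.
by rewrite ler_peMl ?ler1n// ltW ?dyad_gt0.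
Qed.

Definition graph_domain : closedSubspace H1 :=
  ClosedSubspace graph_dom_submod graph_dom_closed.

End GraphDomain.

Lemma isometric_graph_flip (R : realType) (H1 H2 : hilbertType R)
    (G : H1 -> H2 -> Prop) :
  isometric_graph G -> isometric_graph (fun y x => G x y).
Proof.
case=> G0 GL Gn Gcl; split => //.
- move=> c x y x0 y0 ? ?; exact: GL.
- by move=> x y /Gn.
- move=> y x h; apply: Gcl => e /h[y' [x' [? ? ?]]].
  by exists x', y'.
Qed.

Section GraphUnitary.
Context (R : realType) d (X : measurableType d) (H1 H2 : hilbertType R).
Variables (pi1 : spectralMeasure X H1) (pi2 : spectralMeasure X H2).
Variable G : H1 -> H2 -> Prop.
Hypothesis isoG : isometric_graph G.
Hypothesis Gpi : forall A, measurable A ->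
  forall x y, G x y -> G (pi1 A x) (pi2 A y).
Local Open Scope complex_scope.

Let K1 := graph_domain isoG.
Let K2 := graph_domain (isometric_graph_flip isoG).

Lemma graph_domain_inv1 : invariant_subspace pi1 K1.
Proof.
move=> A mA x /graph_domP[y Gxy]; apply/graph_domP.
by exists (pi2 A y); exact: Gpi.
Qed.

Lemma graph_domain_inv2 : invariant_subspace pi2 K2.
Proof.
move=> A mA y /graph_domP[x Gxy]; apply/graph_domP.
by exists (pi1 A x); exact: Gpi.
Qed.

Let graph_ex (x : subspace_of K1) : exists y, G (cs_val x) y.
Proof. exact/graph_domP/(cs_valP x). Qed.

Let im x := proj1_sig (cid (graph_ex x)).

Let imP x : G (cs_val x) (im x).
Proof. exact: proj2_sig (cid (graph_ex x)). Qed.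

Let im_mem x : im x \in K2.
Proof. by apply/graph_domP; exists (cs_val x). Qed.

Let U x : subspace_of K2 := SubspaceVec (im_mem x).

Let U_nrm x : nrm (U x) = nrm x.
Proof. by case: isoG => _ _ Gn _; exact/esym/Gn/imP. Qed.

Let U_linear : linear U.
Proof.
move=> c x y; apply: val_inj; apply: (graph_uniq isoG (imP _)).
have [_ GL _ _] := isoG; exact: (GL _ _ _ _ _ (imP x) (imP y)).
Qed.

Let U_bounded : exists M : R, forall x, `|U x| <= M%:C * `|x|.
Proof. by exists 1 => x; rewrite mul1r !normE U_nrm lexx. Qed.

Lemma graph_unitary :
  unitarily_equivalent (sub_spectral graph_domain_inv1)
    (sub_spectral graph_domain_inv2).
Proof.
exists (BoundedOp U_linear U_bounded); split; first split.
- by apply: isometry_inner => x; exact: U_nrm.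
- move=> y; have /graph_domP[x Gxy] := cs_valP y.
  have xK : x \in K1 by apply/graph_domP; exists (cs_val y).
  exists (SubspaceVec xK); apply: val_inj.
  by apply: (graph_uniq isoG (imP (SubspaceVec xK))).
- move=> A mA x; apply: val_inj; apply: (graph_uniq isoG (imP _)).
  by rewrite /= !sub_opE//; apply: Gpi => //; exact: imP.
Qed.

End GraphUnitary.

Section CyclicGraph.
Context (R : realType) d (X : measurableType d) (H1 H2 : hilbertType R).
Variables (pi1 : spectralMeasure X H1) (pi2 : spectralMeasure X H2).
Variables (h : H1) (k : H2).
Hypothesis hk : forall A, measurable A -> weight pi1 h A = weight pi2 k A.
Local Open Scope complex_scope.

(** Pairs of the same linear combination of translates pi1(A) h and pi2(A) k. *)
Inductive orbit : H1 -> H2 -> Prop :=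
| orbit0 : orbit 0 0
| orbitS (c : R[i]) A x y : measurable A -> orbit x y ->
    orbit (c *: pi1 A h + x) (c *: pi2 A k + y).

Lemma orbit_lin (c : R[i]) x y x' y' : orbit x y -> orbit x' y' ->
  orbit (c *: x + x') (c *: y + y').
Proof.
move=> xy xy'; elim: xy => [|a A x0 y0 mA _ IH].
  by rewrite !scaler0 !add0r.
by rewrite !scalerDr !scalerA -!addrA; exact: orbitS.
Qed.

Lemma orbit_pi A x y : measurable A -> orbit x y -> orbit (pi1 A x) (pi2 A y).
Proof.
move=> mA; elim=> [|a B x0 y0 mB _ IH].
  by rewrite !linear0; exact: orbit0.
by rewrite !linearP/= !sm_setI//; apply: orbitS => //; exact: measurableI.
Qed.

Lemma orbit_inner x y x' y' : orbit x y -> orbit x' y' ->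
  inner x x' = inner y y'.
Proof.
move=> xy xy'; elim: xy => [|c A x0 y0 mA _ IH]; first by rewrite !linear0l.
rewrite !innerDl IH !innerZl; congr (_ * _ + _).
elim: xy' {IH} => [|c' B x1 y1 mB _ IH]; first by rewrite !linear0r.
rewrite !innerDr IH !innerZr !inner_sm// hk//.
exact: measurableI.
Qed.

Lemma orbit_nrm x y : orbit x y -> nrm x = nrm y.
Proof.
move=> oxy; apply/eqP; rewrite -(@eqrXn2 _ 2) ?nrm_ge0// -!rdotxx /rdot.
by rewrite (orbit_inner oxy oxy).
Qed.

Definition cyclic_graph x y := forall e : R, 0 < e -> exists x' y',
  [/\ orbit x' y', nrm (x - x') < e & nrm (y - y') < e].

Lemma orbit_cyclic x y : orbit x y -> cyclic_graph x y.
Proof. by move=> xy e e0; exists x, y; rewrite !subrr !nrm0. Qed.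

Lemma cyclic_graph_isometric : isometric_graph cyclic_graph.
Proof.
split.
- exact/orbit_cyclic/orbit0.
- move=> c x y x' y' G G' e e0; pose a : R := complex.Re `|c|.
  have a0 : 0 <= a by rewrite -ler0c RRe_real ?normr_real.
  have a1 : 0 < a + 1 by rewrite ltr_wpDl.
  have t0 : 0 < e / (a + 1) by rewrite divr_gt0.
  have [x0 [y0 [oxy0 ox oy]]] := G _ t0.
  have [x1 [y1 [oxy1 ox' oy']]] := G' _ t0.
  have ee : e = a * (e / (a + 1)) + e / (a + 1).
    by rewrite -{2}[e / _]mul1r -mulrDl mulrC divfK// gt_eqF.
  have bound (H : hilbertType R) (u u' v v' : H) : nrm (u - u') < e / (a + 1) ->
      nrm (v - v') < e / (a + 1) -> nrm (c *: u + v - (c *: u' + v')) < e.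
    move=> uu' vv'; rewrite opprD addrACA -scalerBr.
    apply: le_lt_trans (nrmD _ _) _; rewrite nrmZc [ltRHS]ee.
    by rewrite ler_ltD// ler_wpM2l// ltW.
  exists (c *: x0 + x1), (c *: y0 + y1); split; last 2 first.
  + exact: bound.
  + exact: bound.
  + exact: orbit_lin.
- move=> x y G; apply/eqP; rewrite -subr_eq0 -normr_le0.
  apply/ler_addgt0Pr => e e0; rewrite add0r.
  have e20 : 0 < e / 2 by rewrite divr_gt0.
  have [x' [y' [oxy ox oy]]] := G _ e20.
  have -> : nrm x - nrm y = (nrm x - nrm x') - (nrm y - nrm y').
    by rewrite (orbit_nrm oxy); ring.
  apply: le_trans (ler_normB _ _) _; rewrite [leRHS]splitr.
  by rewrite lerD// (le_trans (nrm_dist _ _))// ltW.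
- move=> x y cl e e0.
  have e20 : 0 < e / 2 by rewrite divr_gt0.
  have [x' [y' [G ox oy]]] := cl _ e20.
  have [x'' [y'' [oxy ox' oy']]] := G _ e20.
  exists x'', y''; split => //.
    by apply: le_lt_trans (nrm_triangle x' _ _) _; rewrite [ltRHS]splitr ltrD.
  by apply: le_lt_trans (nrm_triangle y' _ _) _; rewrite [ltRHS]splitr ltrD.
Qed.

Lemma cyclic_graph_pi A : measurable A -> forall x y,
  cyclic_graph x y -> cyclic_graph (pi1 A x) (pi2 A y).
Proof.
move=> mA x y G e /G[x' [y' [oxy ox oy]]].
exists (pi1 A x'), (pi2 A y'); split; first exact: orbit_pi.
- by rewrite -linearB; apply: le_lt_trans ox; exact: nrm_sm.
- by rewrite -linearB; apply: le_lt_trans oy; exact: nrm_sm.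
Qed.

(** A pair of vectors of equal weights generates an intertwining isometric
    graph, whose domain contains h; under disjointness this forces h = 0, and k
    has the same norm as h. *)
Lemma equal_weight_disjoint : disjoint_spectral pi1 pi2 -> k = 0.
Proof.
move=> dis.
have oxy : orbit h k.
  have := orbitS 1 (measurableT : measurable [set: X]) orbit0.
  by rewrite !scale1r !addr0 !sm_total.
suff h0 : h = 0.
  by apply: nrm_le0; rewrite -(orbit_nrm oxy) h0 nrm0.
apply: contrapT => /eqP h0.
apply: (dis _ _ _ _ _ (graph_unitary cyclic_graph_isometric cyclic_graph_pi)).
exists h => //; apply/graph_domP; exists k; exact: orbit_cyclic.
Qed.

End CyclicGraph.

(** * Intertwining operators *)

Section Intertwiners.
Context (R : realType) d (X : measurableType d) (H1 H2 : hilbertType R).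
Variables (pi1 : spectralMeasure X H1) (pi2 : spectralMeasure X H2).
Local Open Scope complex_scope.

Lemma singular_intertwiner : mutually_singular pi1 pi2 ->
  forall T : boundedOp H1 H2,
    (forall A, measurable A -> forall x, T (pi1 A x) = pi2 A (T x)) ->
    forall x, T x = 0.
Proof.
move=> [X1 [X2 [mX1 mX2 X12 sing]]] T Tpi x.
have [s1 _] := sing _ (measurableT : measurable [set: X]).
have [_ s2] := sing _ mX1.
rewrite -(sm_total pi1 x) s1 setTI Tpi// s2 X12.
exact: sm_set0.
Qed.

(** The projections pi1(A) are self-adjoint, so they preserve the orthogonal
    complement of K as well as K. *)
Lemma orthoproj_sm (K : closedSubspace H1) : invariant_subspace pi1 K ->
  forall A, measurable A -> forall x,
    orthoproj K (pi1 A x) = pi1 A (orthoproj K x).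
Proof.
move=> Kpi A mA x; apply: orthoproj_uniq; first exact/(Kpi _ mA)/orthoproj_mem.
move=> u uK; rewrite -linearB sm_sym// orthoproj_orth//.
exact: Kpi.
Qed.

(** A unitary U from K1 onto K2 extends to the intertwiner U o P, where P is the
    orthogonal projection onto K1. *)
Lemma intertwiner_disjoint :
  (forall T : boundedOp H1 H2,
    (forall A, measurable A -> forall x, T (pi1 A x) = pi2 A (T x)) ->
    forall x, T x = 0) -> disjoint_spectral pi1 pi2.
Proof.
move=> T0 K1 K2 K1pi K2pi [x xK x0] [U [[Uin _] Upi]].
pose T z := cs_val (U (SubspaceVec (orthoproj_mem K1 z))).
have Tlin : linear T.
  move=> c y z; rewrite /T.
  have -> : SubspaceVec (orthoproj_mem K1 (c *: y + z)) =
      c *: SubspaceVec (orthoproj_mem K1 y) + SubspaceVec (orthoproj_mem K1 z).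
    by apply: val_inj; exact: orthoproj_linear.
  by rewrite linearP.
have Tn z : nrm (T z) = nrm (orthoproj K1 z).
  apply/eqP; rewrite -(@eqrXn2 _ 2) ?nrm_ge0// -!rdotxx; apply/eqP.
  by congr (complex.Re _); exact: Uin.
have Tbd : exists M : R, forall z, `|T z| <= M%:C * `|z|.
  by exists 1 => z; rewrite mul1r !normE lecR Tn nrm_orthoproj.
suff : T x = 0.
  move=> Tx; case/eqP: x0; apply: nrm_eq0.
  by rewrite -(orthoproj_id xK) -Tn Tx nrm0.
apply: (T0 (BoundedOp Tlin Tbd)) => A mA z /=; rewrite /T.
have -> : SubspaceVec (orthoproj_mem K1 (pi1 A z)) =
    sub_spectral K1pi A (SubspaceVec (orthoproj_mem K1 z)).
  by apply: val_inj; rewrite /= sub_opE//; exact: orthoproj_sm.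
by rewrite Upi//= sub_opE.
Qed.

End Intertwiners.

Theorem theorem4p5 (R : realType) (d : measure_display) (X : measurableType d)
    (measurable_singleton : forall x : X, measurable [set x])
    (H1 H2 : hilbertType R)
    (sepH1 : separable_space H1) (sepH2 : separable_space H2)
    (pi1 : spectralMeasure X H1) (pi2 : spectralMeasure X H2) :
  (mutually_singular pi1 pi2 <-> disjoint_spectral pi1 pi2) /\
  (disjoint_spectral pi1 pi2 <->
    forall T : boundedOp H1 H2,
      (forall A, measurable A -> forall x, T (pi1 A x) = pi2 A (T x)) ->
      forall x, T x = 0).
Proof.
have dis_sing : disjoint_spectral pi1 pi2 -> mutually_singular pi1 pi2.
  move=> dis; apply: separated_singular => // h k hk.
  exact: equal_weight_disjoint hk dis.
split; split => //.
- by move=> /singular_intertwiner/intertwiner_disjoint.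
- by move=> /dis_sing/singular_intertwiner.
- exact: intertwiner_disjoint.
Qed.
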